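(* Let $\Omega\subset\mathbb{R}^n$ be a nonempty open bounded set, let $u$ be the solution to the Dirichlet problem $-\Delta_\infty u=1$ in $\Omega$, $u=0$ on $\partial\Omega$, let $K$ be the set of points where $u$ attains its maximum over $\overline\Omega$, and let $A\subset\Omega$ be a neighborhood of $K$. Assume that $u\in C^{1,1}(A\setminus K)$. Then for every $\alpha>1/3$ it holds $u\notin C^{1,\alpha}(A)$.
   Context: For smooth $\varphi$, $\Delta_\infty\varphi:=\langle\nabla^2\varphi\,\nabla\varphi,\nabla\varphi\rangle$. A solution to the Dirichlet problem is a function $u\in C(\overline\Omega)$ with $u=0$ on $\partial\Omega$ which is a viscosity solution of $-\Delta_\infty u=1$ in $\Omega$, i.e. for every $x_0\in\Omega$ and $\varphi\in C^2(\Omega)$: if $u-\varphi$ has a local maximum at $x_0$ then $-\Delta_\infty\varphi(x_0)-1\le 0$, and if $u-\varphi$ has a local minimum at $x_0$ then $-\Delta_\infty\varphi(x_0)-1\ge 0$. It is known that the solution exists, is unique, and is strictly positive in $\Omega$. $u\in C^{1,1}(A\setminus K)$ means that $u$ is $C^1$ with locally Lipschitz gradient in $A\setminus K$. $u\in C^{1,\alpha}(A)$ means that $u\in C^1(A)$ and there exists $C>0$ with $|\nabla u(x)-\nabla u(y)|\le C|x-y|^\alpha$ for all $x,y\in A$. *)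

(* Defs.v *)
From mathcomp Require Export all_boot all_order all_algebra.
From mathcomp Require Export all_classical all_reals all_analysis.
Set Implicit Arguments.
Unset Strict Implicit.
Unset Printing Implicit Defensive.
Export Order.TTheory GRing.Theory Num.Theory.
Export numFieldNormedType.Exports.
Local Open Scope classical_set_scope.
Local Open Scope ring_scope.

(* The library norm on 'rV[R]_n is the max norm; |.| is the Euclidean one. It
   induces the same topology, so open, closed, bounded, continuous and
   differentiable are the library's. *)
Definition dot (R : realType) (n : nat) (v w : 'rV[R]_n) : R :=
  \sum_(i < n) v 0 i * w 0 i.

Definition enorm (R : realType) (n : nat) (v : 'rV[R]_n) : R :=
  Num.sqrt (dot v v).

Definition basis_vec (R : realType) (n : nat) (i : 'I_n) : 'rV[R]_n :=
  delta_mx 0 i.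

Definition partial (R : realType) (n : nat) (i : 'I_n) (f : 'rV[R]_n -> R) :
  'rV[R]_n -> R := fun x => 'D_(basis_vec R i) f x.

Definition gradient (R : realType) (n : nat) (f : 'rV[R]_n -> R)
  (x : 'rV[R]_n) : 'rV[R]_n := \row_(i < n) partial i f x.

Definition hessian (R : realType) (n : nat) (f : 'rV[R]_n -> R)
  (x : 'rV[R]_n) : 'M[R]_n :=
  \matrix_(i < n, j < n) partial j (partial i f) x.

(* Vectors are rows, so the matrix-vector product H v is v *m H^T. *)
Definition inf_laplacian (R : realType) (n : nat) (f : 'rV[R]_n -> R)
  (x : 'rV[R]_n) : R :=
  dot (gradient f x *m (hessian f x)^T) (gradient f x).

(* Functions are total on R^n; [differentiable] is Frechet differentiability as
   a function on R^n, so these notions depend only on f near A. A need not be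
   open: continuity of the gradient is relative to A. *)
Definition C1_on (R : realType) (n : nat) (A : set 'rV[R]_n)
  (f : 'rV[R]_n -> R) : Prop :=
  (forall x, A x -> differentiable f x) /\ {within A, continuous (gradient f)}.

Definition C2_on (R : realType) (n : nat) (A : set 'rV[R]_n)
  (f : 'rV[R]_n -> R) : Prop :=
  C1_on A f /\ forall i : 'I_n, C1_on A (partial i f).

Definition C11_on (R : realType) (n : nat) (A : set 'rV[R]_n)
  (f : 'rV[R]_n -> R) : Prop :=
  C1_on A f /\
  forall x, A x -> exists U : set 'rV[R]_n, exists L : R, nbhs x U /\
    forall y z, (A `&` U) y -> (A `&` U) z ->
      enorm (gradient f y - gradient f z) <= L * enorm (y - z).

Definition C1alpha_on (R : realType) (n : nat) (alpha : R)
  (A : set 'rV[R]_n) (f : 'rV[R]_n -> R) : Prop :=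
  C1_on A f /\
  exists C : R, 0 < C /\
    forall x y, A x -> A y ->
      enorm (gradient f x - gradient f y) <= C * enorm (x - y) `^ alpha.

Definition local_max_at (R : realType) (n : nat) (f : 'rV[R]_n -> R)
  (x0 : 'rV[R]_n) : Prop := \forall x \near x0, f x <= f x0.

Definition local_min_at (R : realType) (n : nat) (f : 'rV[R]_n -> R)
  (x0 : 'rV[R]_n) : Prop := \forall x \near x0, f x0 <= f x.

Definition viscosity_solution (R : realType) (n : nat) (Omega : set 'rV[R]_n)
  (u : 'rV[R]_n -> R) : Prop :=
  forall (x0 : 'rV[R]_n) (phi : 'rV[R]_n -> R), Omega x0 -> C2_on Omega phi ->
    (local_max_at (fun x => u x - phi x) x0 ->
       - inf_laplacian phi x0 - 1 <= 0) /\
    (local_min_at (fun x => u x - phi x) x0 ->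
       0 <= - inf_laplacian phi x0 - 1).

Definition boundary (R : realType) (n : nat) (A : set 'rV[R]_n) :
  set 'rV[R]_n := closure A `\` A°.

(* The values of u outside the closure of Omega are irrelevant. *)
Definition dirichlet_solution (R : realType) (n : nat) (Omega : set 'rV[R]_n)
  (u : 'rV[R]_n -> R) : Prop :=
  [/\ {within closure Omega, continuous u},
      forall x, boundary Omega x -> u x = 0 &
      viscosity_solution Omega u].

Definition max_set (R : realType) (n : nat) (Omega : set 'rV[R]_n)
  (u : 'rV[R]_n -> R) : set 'rV[R]_n :=
  [set x | closure Omega x /\ forall y, closure Omega y -> u y <= u x].

(* Main.v *)
(* At a maximum point x0 the gradient vanishes, so the Hoelder bound gives
   u(x) >= u(x0) - C |x - x0|^(1 + alpha). On the sphere of radius r this beats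
   u(x0) - a |x - x0|^2 with a = 2 C r^(alpha - 1), so this paraboloid, suitably
   translated, touches u from below inside the ball. The supersolution property
   then forces 1 <= 8 a^3 r^2 = 64 C^3 r^(3 alpha - 1), which fails for small r
   because alpha > 1/3. *)
Require Import Defs.
From mathcomp Require Import ring lra.
Local Open Scope classical_set_scope.
Local Open Scope ring_scope.

Section euclidean.
Context {R : realType} {n : nat}.
Implicit Types (v w x c : 'rV[R]_n) (a b r : R).

(** * Euclidean inner product and norm *)

Lemma dotC v w : dot v w = dot w v.
Proof. by apply: eq_bigr => i _; rewrite mulrC. Qed.

Lemma dotDl v1 v2 w : dot (v1 + v2) w = dot v1 w + dot v2 w.
Proof. by rewrite -big_split; apply: eq_bigr => i _; rewrite mxE mulrDl. Qed.

Lemma dotZl a v w : dot (a *: v) w = a * dot v w.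
Proof. by rewrite [RHS]mulr_sumr; apply: eq_bigr => i _; rewrite mxE mulrA. Qed.

Lemma dot0l w : dot 0 w = 0.
Proof. by apply: big1 => i _; rewrite mxE mul0r. Qed.

Lemma dotDr v w1 w2 : dot v (w1 + w2) = dot v w1 + dot v w2.
Proof. by rewrite !(dotC v) dotDl. Qed.

Lemma dotZr a v w : dot v (a *: w) = a * dot v w.
Proof. by rewrite !(dotC v) dotZl. Qed.

Lemma dotvv_ge0 v : 0 <= dot v v.
Proof. by apply: sumr_ge0 => i _; rewrite -expr2 sqr_ge0. Qed.

Lemma enorm_ge0 v : 0 <= enorm v.
Proof. exact: sqrtr_ge0. Qed.

Lemma sqr_enorm v : enorm v ^+ 2 = dot v v.
Proof. by rewrite sqr_sqrtr// dotvv_ge0. Qed.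

Lemma enormZ a v : enorm (a *: v) = `|a| * enorm v.
Proof.
by rewrite /enorm dotZl dotZr mulrA -expr2 sqrtrM ?sqr_ge0// sqrtr_sqr.
Qed.

Lemma normr_coord_le_enorm v i : `|v 0 i| <= enorm v.
Proof.
rewrite -(@ler_pXn2r _ 2)// ?nnegrE ?enorm_ge0// sqr_enorm real_normK ?num_real//.
rewrite /dot (bigD1 i)//= -expr2 lerDl.
by apply: sumr_ge0 => j _; rewrite -expr2 sqr_ge0.
Qed.

(** Bridge to the library's max norm: Euclidean control yields boundedness and membership in library
    balls. *)
Lemma norm_le_enorm v : `|v| <= enorm v.
Proof.
rewrite [`|v|]mx_normrE; apply: bigmax_le; first exact: enorm_ge0.
by move=> [i j] _; rewrite ord1 normr_coord_le_enorm.
Qed.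

Lemma enorm_eq0 v : enorm v = 0 -> v = 0.
Proof.
by move=> v0; apply/eqP; rewrite -normr_le0 -v0 norm_le_enorm.
Qed.

Lemma cauchy_schwarz v w : dot v w <= enorm v * enorm w.
Proof.
have [v0|v0] := eqVneq (enorm v) 0.
  by rewrite v0 mul0r (enorm_eq0 _ v0) dot0l.
have [w0|w0] := eqVneq (enorm w) 0.
  by rewrite w0 mulr0 (enorm_eq0 _ w0) dotC dot0l.
have vw : 0 < enorm v * enorm w.
  by rewrite mulr_gt0// lt_neqAle eq_sym ?v0 ?w0 enorm_ge0.
(* The square expands to [2 * |v| * |w| * (|v| * |w| - dot v w)], whose first factors are positive
   here. *)
have := dotvv_ge0 (enorm w *: v + - enorm v *: w).
rewrite !(dotDl, dotDr) !(dotZl, dotZr) (dotC w v) -!sqr_enorm => h.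
rewrite -(ler_pM2l vw); nra.
Qed.

(** * Derivatives along lines and growth near critical points *)

Lemma is_derive_coord x v i : is_derive x v (fun y : 'rV[R]_n => y 0 i) (v 0 i).
Proof.
have dv : derivable (@id 'rV[R]_n) x v by exact: derivable_id.
apply: DeriveDef; first by have /derivable_mxP := dv; exact.
have := derive_mx dv; rewrite derive_id => /matrixP/(_ 0 i).
by rewrite mxE => <-.
Qed.

Lemma derive_gradient (f : 'rV[R]_n -> R) x v :
  differentiable f x -> 'D_v f x = dot (gradient f x) v.
Proof.
move=> df; rewrite deriveE// {1}(row_sum_delta v) linear_sum.
by apply: eq_bigr => i _; rewrite linearZ/= -deriveE// !mxE mulrC.
Qed.

(** The difference quotients in [t] coincide with those of [f] along [v], so one-variable theorems
    can be used on lines. *)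
Lemma is_derive_line (f : 'rV[R]_n -> R) x v (t : R) :
  differentiable f (x + t *: v) ->
  is_derive t 1 (fun s => f (x + s *: v)) ('D_v f (x + t *: v)).
Proof.
move=> /diff_derivable-/(_ v) df.
have e : (fun h : R => h^-1 *: (((fun s => f (x + s *: v)) \o shift t) (h *: 1)
    - f (x + t *: v))) =
    (fun h => h^-1 *: ((f \o shift (x + t *: v)) (h *: v) - f (x + t *: v))).
  apply/funext => h /=; congr (_ *: (f _ - _)).
  by rewrite [h *: 1]mulr1 scalerDl addrCA.
by apply: DeriveDef; rewrite /derivable /derive e.
Qed.

(** Fermat's rule in one variable, applied on the line through [x] in each coordinate direction. *)
Lemma gradient_local_max (f : 'rV[R]_n -> R) x :
  (\forall y \near x, differentiable f y) -> local_max_at f x ->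
  gradient f x = 0.
Proof.
move=> df fx; apply/rowP => i; rewrite !mxE /partial.
have : \forall y \near x, differentiable f y /\ f y <= f x.
  by near=> y; split; near: y.
set v := basis_vec R i => H.
have cv : (fun t : R => x + t *: v) @ 0 --> x.
  have : (fun t : R => x + t *: v) @ 0 --> x + 0 *: v.
    by apply: cvgD; [exact: cvg_cst|apply: cvgZr_tmp; exact: cvg_id].
  by rewrite scale0r addr0.
have /nbhs_ballP[e /= e0 He] := cv _ H.
(* The neighborhood of [x] is pulled back to an interval around [0] on the line. *)
have H' t : t \in `]-e, e[ ->
    differentiable f (x + t *: v) /\ f (x + t *: v) <= f x.
  rewrite in_itv/= => te; apply: (He t).
  by rewrite /ball/= sub0r normrN ltr_norml.
have e0' : 0 \in `]-e, e[ by rewrite in_itv/= oppr_lt0 e0.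
have /is_derive_line[_ d0] := (H' _ e0').1.
have [||t /H'[]|_] :=
  @derive1_at_max R (fun t => f (x + t *: v)) (- e) e 0 _ _ e0'.
- by lra.
- by move=> t /H'[+ _] => /is_derive_line[].
- by rewrite scale0r addr0.
by rewrite d0 scale0r addr0.
Unshelve. all: by end_near. Qed.


(** By the mean value theorem, [f x - f x0] is the inner product of [h] with the gradient at a point
    [y] of the segment. As the gradient vanishes at [x0], its norm at [y] is at most
    [C * |y - x0| ^ alpha], hence at most [C * |h| ^ alpha] because [0 <= alpha]. Cauchy-Schwarz
    concludes. *)
Lemma ge_growth_at_critical (f : 'rV[R]_n -> R) x0 r (alpha C : R) :
  0 <= alpha -> 0 <= C -> gradient f x0 = 0 ->
  (forall y, enorm (y - x0) <= r -> differentiable f y /\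
    enorm (gradient f y - gradient f x0) <= C * enorm (y - x0) `^ alpha) ->
  forall x, enorm (x - x0) <= r ->
  f x0 - C * enorm (x - x0) `^ alpha * enorm (x - x0) <= f x.
Proof.
move=> alpha0 C0 g0 H x xr.
set h := x - x0 in xr *.
have seg t : t \in `[0, 1] -> enorm (x0 + t *: h - x0) <= enorm h.
  rewrite in_itv/= => /andP[t0 t1].
  by rewrite addrAC subrr add0r enormZ ger0_norm// ler_piMl// enorm_ge0.
have dseg t : t \in `[0, 1] -> differentiable f (x0 + t *: h).
  by move=> /seg ht; apply: (H _ _).1; exact: le_trans xr.
have [|t|t t01 e] := @MVT_segment R (fun t => f (x0 + t *: h))
    (fun t => 'D_h f (x0 + t *: h)) 0 1 ler01.
- by move=> t /subset_itv_oo_cc/dseg; exact: is_derive_line.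
- move: t; apply: derivable_within_continuous => t /dseg.
  by move=> /is_derive_line[].
have xE : x0 + h = x by rewrite /h addrC subrK.
move: e; rewrite scale0r addr0 scale1r xE subr0 mulr1.
rewrite derive_gradient; last exact: dseg.
set y := x0 + t *: h => e.
have [|_ gy] := H y; first by rewrite (le_trans (seg _ t01)).
rewrite lerBlDr -lerBlDl.
have -> : f x0 - f x = dot (- gradient f y) h.
  by rewrite -(scaleN1r (gradient f y)) dotZl mulN1r -e opprB.
apply: (le_trans (cauchy_schwarz _ _)).
rewrite ler_wpM2r ?enorm_ge0//.
rewrite -scaleN1r enormZ normrN1 mul1r.
move: gy; rewrite g0 subr0 => /le_trans; apply.
rewrite ler_wpM2l// ge0_ler_powR ?nnegrE ?enorm_ge0//.
exact: seg.
Qed.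

(** * Paraboloids as test functions *)

Definition quadratic a c := fun x => a * dot (x - c) (x - c).

Lemma is_derive_quadratic a c x v :
  is_derive x v (quadratic a c) (2 * a * dot (x - c) v).
Proof.
(* A sum of squared coordinate functions, to which the rules for sums and powers apply. *)
have -> : quadratic a c = a \*: \sum_(i < n) (fun y : 'rV[R]_n =>
    y 0 i - c 0 i) ^+ 2.
  apply/funext => y; rewrite /quadratic/= fct_sumE; congr (_ * _).
  by apply: eq_bigr => i _; rewrite !mxE.
have D (i : 'I_n) : is_derive x v (fun y : 'rV[R]_n => y 0 i - c 0 i) (v 0 i).
  have D1 := is_derive_coord x v i.
  by have := is_deriveB D1 (is_derive_cst (c 0 i) x v); rewrite subr0.
have H := is_deriveZ a (is_derive_sum (fun i => is_deriveX 2 (D i))).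
apply: (@is_derive_eq _ _ _ _ _ _ _ _ H).
rewrite [LHS]/GRing.scale/= !mulr_sumr.
apply: eq_bigr => i _.
by rewrite !mxE -[_ *: _]/(2 * (x 0 i - c 0 i) ^+ 1 * v 0 i); ring.
Qed.

Lemma partial_quadratic a c i :
  partial i (quadratic a c) = fun x => 2 * a * (x 0 i - c 0 i).
Proof.
apply/funext => x; rewrite /partial.
have [_ ->] := is_derive_quadratic a c x (basis_vec R i).
rewrite /dot (bigD1 i)//= big1 => [|j ji].
  by rewrite addr0 !mxE !eqxx mulr1.
by rewrite !mxE (negbTE ji) andbF mulr0.
Qed.

Lemma gradient_quadratic a c :
  gradient (quadratic a c) = fun x => (2 * a) *: (x - c).
Proof.
by apply/funext => x; apply/rowP => i; rewrite !mxE partial_quadratic.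
Qed.

Lemma partial2_quadratic a c i j :
  partial j (partial i (quadratic a c)) = cst (2 * a * (i == j)%:R).
Proof.
rewrite partial_quadratic; apply/funext => x.
have D1 := is_derive_coord x (basis_vec R j) i.
have [_ E] := is_deriveZ (2 * a) (is_deriveB D1 (is_derive_cst (c 0 i) x _)).
by rewrite /partial [LHS]E subr0 !mxE eqxx.
Qed.

Lemma hessian_quadratic a c x : hessian (quadratic a c) x = (2 * a)%:M.
Proof.
by apply/matrixP => i j; rewrite !mxE partial2_quadratic mulr_natr.
Qed.

(** The gradient is [2a(x - c)] and the Hessian is [2a] times the identity, so three factors [2a]
    appear. *)
Lemma inf_laplacian_quadratic a c x :
  inf_laplacian (quadratic a c) x = 8 * a ^+ 3 * dot (x - c) (x - c).
Proof.
rewrite /inf_laplacian hessian_quadratic gradient_quadratic tr_scalar_mx.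
by rewrite mul_mx_scalar !(dotZl, dotZr); ring.
Qed.

Lemma differentiable_affine_coord a b (i : 'I_n) x :
  differentiable (fun y : 'rV[R]_n => a * (y 0 i - b)) x.
Proof.
apply: differentiableZ; apply: differentiableB; last exact: differentiable_cst.
exact: differentiable_coord.
Qed.

Lemma differentiable_quadratic a c x : differentiable (quadratic a c) x.
Proof.
(* The factor [1] gives both terms of each product the shape of [differentiable_affine_coord]. *)
have -> : quadratic a c = \sum_(i < n) ((fun y : 'rV[R]_n =>
    a * (y 0 i - c 0 i)) * (fun y => 1 * (y 0 i - c 0 i))).
  apply/funext => y; rewrite fct_sumE /quadratic mulr_sumr.
  by apply: eq_bigr => i _; rewrite !mxE [RHS]/GRing.mul/= mul1r mulrA.
apply: differentiable_sum => i.
by apply: differentiableM; exact: differentiable_affine_coord.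
Qed.

Lemma C2_quadratic a c (A : set 'rV[R]_n) : C2_on A (quadratic a c).
Proof.
split=> [|i]; split.
- by move=> x _; exact: differentiable_quadratic.
- rewrite gradient_quadratic; apply: continuous_subspaceT => x.
  apply/differentiable_continuous/differentiableZ/differentiableB.
    exact: ex_diff.
  exact: differentiable_cst.
- move=> x _; rewrite partial_quadratic.
  exact: differentiable_affine_coord.
- apply: continuous_subspaceT.
  have -> : gradient (partial i (quadratic a c)) =
      cst (\row_j (2 * a * (i == j)%:R)).
    by apply/funext => x; apply/rowP => j; rewrite !mxE partial2_quadratic.
  exact: cst_continuous.
Qed.

(** * Comparison with a paraboloid on a Euclidean ball *)

Lemma continuous_dist2 c : continuous (fun x => dot (x - c) (x - c)).
Proof.
move=> x; have := differentiable_continuous (differentiable_quadratic 1 c x).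
by rewrite (_ : quadratic 1 c = fun x => dot (x - c) (x - c))//;
  apply/funext => y; rewrite /quadratic mul1r.
Qed.

(** Here [r] bounds the squared distance, which makes the set a preimage under a polynomial map and
    avoids square roots. *)
Lemma compact_eball c r : compact [set x | dot (x - c) (x - c) <= r].
Proof.
apply: bounded_closed_compact; last first.
  rewrite [X in closed X](_ : _ =
    (fun x => dot (x - c) (x - c)) @^-1` [set y | y <= r])//.
  by apply: preimage_closed; [move=> x _; exact: continuous_dist2|
    exact: closed_le].
exists (`|c| + Num.sqrt r); split; first exact: num_real.
move=> M ltM x /= xr; apply: le_trans (ltW ltM).
rewrite -[x](subrK c) addrC (le_trans (ler_normD _ _))// lerD2l.
by rewrite (le_trans (norm_le_enorm _))// ler_wsqrtr.
Qed.

(* Compare u with u(x0) - a |x - x0|^2: the minimum of the difference over the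
   ball cannot lie on the sphere, so it is interior and the equation applies. *)
Lemma viscosity_sphere_bound (Omega : set 'rV[R]_n) (u : 'rV[R]_n -> R) x0 a r :
  viscosity_solution Omega u -> {within Omega, continuous u} ->
  0 <= a -> 0 <= r -> [set x | dot (x - x0) (x - x0) <= r] `<=` Omega ->
  (forall x, dot (x - x0) (x - x0) = r -> u x0 - a * r < u x) ->
  1 <= 8 * a ^+ 3 * r.
Proof.
move=> visc uc a0 r0 DO sph.
set D := [set x | _] in DO.
have Dx0 : D x0 by rewrite /D/= subrr dot0l.
pose f := (u + quadratic a x0) : 'rV[R]_n -> R.
have fc : {within D, continuous f}.
  apply: within_continuousD; first exact: continuous_subspaceW uc.
  apply: continuous_subspaceT => x.
  exact/differentiable_continuous/differentiable_quadratic.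
have [c] := compact_EVT_min (ex_intro _ x0 Dx0) (compact_eball x0 r) fc.
rewrite inE => Dc fmin.
have fE x : f x = u x + a * dot (x - x0) (x - x0) by [].
(* On the sphere [f] exceeds [u x0 = f x0], so a minimizer over the ball lies strictly inside. *)
have cr : dot (c - x0) (c - x0) < r.
  rewrite lt_neqAle; apply/andP; split=> //.
  apply/eqP => /[dup] e /sph.
  have := fmin x0; rewrite inE => /(_ Dx0).
  by rewrite !fE e subrr dot0l mulr0 addr0; lra.
(* Near [c] all points stay in the ball. Adding the paraboloid with [a] means subtracting the one
   with [- a], the actual test function. *)
have cmin : local_min_at (fun x => u x - quadratic (- a) x0 x) c.
  have /= : \forall x \near c, dot (x - x0) (x - x0) < r.
    exact: (continuous_dist2 x0 c _ (lt_nbhsl cr)).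
  apply: filterS => x /ltW xr.
  by have := fmin x; rewrite inE => /(_ xr); rewrite !fE /quadratic; lra.
have [_ /(_ cmin)] := visc c _ (DO _ Dc) (C2_quadratic (- a) x0 Omega).
rewrite inf_laplacian_quadratic => h.
(* The equation at [c] gives [1 <= 8 * a ^+ 3 * |c - x0|^2]; it remains to enlarge the squared
   distance to [r]. *)
have a3 : 0 <= 8 * a ^+ 3 by rewrite mulr_ge0 ?exprn_ge0.
have := ler_wpM2l a3 (ltW cr).
rewrite (_ : (- a) ^+ 3 = - a ^+ 3) in h; last by ring.
by lra.
Qed.

End euclidean.

(** * Maximum points and the final contradiction *)

Lemma max_set_nonempty (R : realType) (n : nat) (Omega : set 'rV[R]_n)
    (u : 'rV[R]_n -> R) :
  Omega !=set0 -> bounded_set Omega ->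
  {within closure Omega, continuous u} -> max_set Omega u !=set0.
Proof.
move=> [x Ox] [M [Mreal bM]] uc.
have cO : compact (closure Omega).
  apply: bounded_closed_compact; last exact: closed_closure.
  exists M; split=> // N MN y Oy.
  (* A closed ball containing [Omega] also contains its closure. *)
  have : closed [set z : 'rV[R]_n | `|z| <= N].
    rewrite [X in closed X](_ : _ =
      (fun z : 'rV[R]_n => `|z|) @^-1` [set t | t <= N])//.
    by apply: preimage_closed; [move=> z _; exact: norm_continuous|
      exact: closed_le].
  move=> /closure_id/seteqP[_]; apply.
  exact: closure_subset (bM N MN) _ Oy.
have [c] := compact_EVT_max (ex_intro _ x (subset_closure Ox)) cO uc.
rewrite inE => Oc cmax; exists c; split=> // y Oy.
by apply: cmax; rewrite inE.
Qed.

Theorem proposition27 (R : realType) (n : nat) (Omega : set 'rV[R]_n)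
  (u : 'rV[R]_n -> R) (A : set 'rV[R]_n)
  (Omega_neq0 : Omega !=set0) (Omega_open : open Omega)
  (Omega_bounded : bounded_set Omega)
  (u_sol : dirichlet_solution Omega u)
  (A_sub : A `<=` Omega) (A_nbhs : set_nbhs (max_set Omega u) A)
  (u_C11 : C11_on (A `\` max_set Omega u) u) :
  forall alpha : R, 3^-1 < alpha -> ~ C1alpha_on alpha A u.
Proof.
move=> alpha alpha3 [[du _] [C [C0 gradC]]].
have [uc _ visc] := u_sol.
have [x0 Kx0] := max_set_nonempty _ _ _ _ Omega_neq0 Omega_bounded uc.
have Ax0 : nbhs x0 A := A_nbhs x0 Kx0.
have uOc : {within Omega, continuous u}.
  by apply: continuous_subspaceW uc; exact: subset_closure.
(* Since [A] is a neighborhood of [x0] inside [Omega], the global maximum is a local one. *)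
have g0 : gradient u x0 = 0.
  apply: gradient_local_max.
    by apply: filterS Ax0 => y; exact: du.
  apply: filterS Ax0 => y /A_sub Oy.
  by apply: Kx0.2; exact: subset_closure.
have /nbhs_ballP[e /= e0 Be] := Ax0.
(* [b] is the exponent of the final power of [r], and [k] is twice its coefficient [64 * C ^+ 3]. *)
pose b := 3 * alpha - 1; pose k := 128 * C ^+ 3.
have b0 : 0 < b by rewrite /b; lra.
have k0 : 0 < k by rewrite /k mulr_gt0// exprn_gt0.
(* The first bound keeps the closed Euclidean ball of radius [r] inside [A]; the second makes
   [k * r ^ b <= 1]. *)
pose r := Num.min (e / 2) (k^-1 `^ b^-1).
have r0 : 0 < r by rewrite lt_min divr_gt0//= powR_gt0// invr_gt0.
have rb : r `^ b <= k^-1.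
  have -> : k^-1 = (k^-1 `^ b^-1) `^ b.
    by rewrite -powRrM mulVf ?gt_eqF// powRr1// invr_ge0 ltW.
  apply: ge0_ler_powR; rewrite ?nnegrE ?powR_ge0 ?(ltW b0) ?(ltW r0)//.
  by rewrite /r ge_min lexx orbT.
have BA y : enorm (y - x0) <= r -> A y.
  move=> yr; apply: Be; rewrite -ball_normE/= distrC.
  apply: le_lt_trans (norm_le_enorm _) _; apply: le_lt_trans yr _.
  by rewrite /r gt_min; apply/orP; left; lra.
have growth := ge_growth_at_critical u x0 r alpha C.
(* With the factor [2], the possible drop [C * r ^ (1 + alpha)] of [u] at distance [r] is half of
   [a * r ^+ 2], hence strictly smaller. *)
pose a := 2 * C * r `^ (alpha - 1).
have p0 : 0 < r `^ (alpha - 1) by exact: powR_gt0.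
have enormE y : dot (y - x0) (y - x0) = enorm (y - x0) ^+ 2.
  by rewrite sqr_enorm.
have aE : 8 * a ^+ 3 * r ^+ 2 = 2^-1 * k * r `^ b.
  have -> : r `^ b = (r `^ (alpha - 1)) ^+ 3 * r ^+ 2.
    rewrite -!powR_mulrn ?powR_ge0 ?(ltW r0)// -powRrM -powRD.
      by congr (_ `^ _); rewrite /b; ring.
    by rewrite (gt_eqF r0) implybT.
  by rewrite /a /k; field.
have := ler_wpM2l (ltW k0) rb; rewrite mulfV ?gt_eqF// => kr.
(* By [aE] and [kr] the right-hand side is at most [1/2]. *)
suff : 1 <= 8 * a ^+ 3 * r ^+ 2 by rewrite aE; lra.
(* The lemma takes the squared radius, here [r ^+ 2]. *)
apply: (viscosity_sphere_bound Omega u x0 _ _ visc uOc).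
- by rewrite /a !mulr_ge0 ?ltW.
- exact: sqr_ge0.
- move=> y /=; rewrite enormE ler_pXn2r ?nnegrE ?enorm_ge0 ?(ltW r0)//.
  by move=> yr; exact/A_sub/BA.
- move=> y; rewrite enormE => /eqP; rewrite eqrXn2 ?enorm_ge0 ?(ltW r0)//.
  move=> /eqP yr.
  apply: (@lt_le_trans _ _
    (u x0 - C * enorm (y - x0) `^ alpha * enorm (y - x0))).
    rewrite yr ltrD2l ltrN2 /a.
    have -> : r `^ alpha = r `^ (alpha - 1) * r.
      by rewrite -{3}(powRr1 (ltW r0)) -powRD ?subrK// (gt_eqF r0) implybT.
    have : 0 < C * r `^ (alpha - 1) * r ^+ 2 by rewrite !mulr_gt0// exprn_gt0.
    by lra.
  apply: growth; rewrite ?yr ?(ltW C0)//; first lra.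
  move=> z zr; split; first exact/du/BA.
  by apply: gradC; [exact: BA|exact: nbhs_singleton].
Qed.
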